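(* Let $r\ge1$ and let $\alpha_1,\dots,\alpha_r>-1$ with $\alpha_i-\alpha_j\notin\mathbb{Z}$ whenever $i\ne j$. For $\vec n\in\mathbb{N}^r$ let $L_{\vec n}$ be the multiple Laguerre polynomial of the first kind, i.e. the monic polynomial of degree $|\vec n|$ satisfying $$\int_0^\infty x^kL_{\vec n}(x)\,x^{\alpha_j}e^{-x}\,dx=0,\qquad k=0,1,\dots,n_j-1,\quad 1\le j\le r.$$ Then the coefficients in the nearest neighbor recurrence relations $$xL_{\vec n}(x)=L_{\vec n+\vec e_k}(x)+b_{\vec n,k}L_{\vec n}(x)+\sum_{j=1}^ra_{\vec n,j}L_{\vec n-\vec e_j}(x),\qquad 1\le k\le r,$$ are given, for all $\vec n\in\mathbb{N}^r$, by $$a_{\vec n,j}=n_j(n_j+\alpha_j)\prod_{i=1,\,i\ne j}^r\frac{n_j+\alpha_j-\alpha_i}{n_j-n_i+\alpha_j-\alpha_i},\qquad 1\le j\le r,$$ $$b_{\vec n,k}=|\vec n|+n_k+\alpha_k+1,\qquad 1\le k\le r.$$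
   Context: $\mathbb{N}=\{0,1,2,\dots\}$, $|\vec n|=n_1+\cdots+n_r$, and $\vec e_j$ is the $j$-th standard unit vector in $\mathbb{N}^r$. Under the stated conditions all multi-indices are normal, i.e. $L_{\vec n}$ exists and is unique for every $\vec n$. The coefficients $a_{\vec n,j}$ do not depend on $k$; when $n_j=0$ one has $a_{\vec n,j}=0$ and the term with $L_{\vec n-\vec e_j}$ is absent. *)

(* Defs.v *)
From HB Require Import structures.
From mathcomp Require Import all_boot all_order all_algebra.
From mathcomp Require Import all_classical all_reals all_analysis.
Set Implicit Arguments.
Unset Strict Implicit.
Unset Printing Implicit Defensive.
Import Order.TTheory GRing.Theory Num.Theory.
Import numFieldNormedType.Exports.
Local Open Scope classical_set_scope.
Local Open Scope ring_scope.

Definition multi_index (r : nat) := {ffun 'I_r -> nat}.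

Definition mi_norm (r : nat) (n : multi_index r) : nat := (\sum_(i < r) n i)%N.

Definition mi_incr (r : nat) (n : multi_index r) (k : 'I_r) : multi_index r :=
  [ffun i => (n i + (i == k))%N].

(* The subtraction is truncated, so this is n - e_k only when 0 < n k. *)
Definition mi_decr (r : nat) (n : multi_index r) (k : 'I_r) : multi_index r :=
  [ffun i => (n i - (i == k))%N].

(* The integral is taken in the extended reals, so that being equal to 0
   cannot come from an infinite value truncated by [fine]. *)
Definition is_multiple_laguerre1 (R : realType) (r : nat) (alpha : 'I_r -> R)
    (n : multi_index r) (p : {poly R}) : Prop :=
  [/\ p \is monic,
      size p = (mi_norm n).+1
    & forall (j : 'I_r) (k : nat), (k < n j)%N ->
        (\int[@lebesgue_measure R]_(x in `]0%R, +oo[)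
           (x ^+ k * p.[x] * (x `^ alpha j * expR (- x)))%:E = 0)%E].

(* Main.v *)
Require Import Defs.
From HB Require Import structures.
From mathcomp Require Import all_boot all_order all_algebra.
From mathcomp Require Import all_classical all_reals all_analysis.
From mathcomp Require Import measurable_realfun ring lra zify.
Import Order.TTheory GRing.Theory Num.Theory.
Import numFieldNormedType.Exports.
Set Implicit Arguments.
Unset Strict Implicit.
Unset Printing Implicit Defensive.
Local Open Scope classical_set_scope.
Local Open Scope ring_scope.

(** The normalised Mellin transform
    [(mellin p)(s) = (1 / Gamma(s+1)) * \int_0^oo p(x) x^s e^-x dx] maps [x^i]
    to the rising factorial [(s+1)...(s+i)]: it is a linear injection of the
    polynomials into themselves which preserves degrees and leading
    coefficients, and multiplication by [x] becomes [P(s) |-> (s+1) P(s+1)].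
    Orthogonality of [p] to [x^k] for the weight [x^alpha_j e^-x] says that
    [mellin p] vanishes at [alpha_j + k], so that the transform of [L_n] is the
    product of the [s - alpha_j - k] for [k < n_j].  After division by common
    factors the recurrence becomes
    [(s+1) prod_i (s-u_i) = (s-y) prod_i (s-t_i)
                            + sum_j a_j prod_(i != j) (s-t_i)],
    where [t_i = alpha_i + n_i - 1], [u_i = alpha_i - 1] and
    [y = alpha_k + n_k - b_k].  Evaluation at [t_j] yields [a_j], and the
    subleading coefficients yield [b_k]. *)

(** * The weights x^s e^-x: integrability, positivity, functional equation of Gamma *)

Section GammaWeight.
Variable R : realType.
Implicit Types (s c x : R).
Local Notation mu := (@lebesgue_measure R).

Definition gamma_weight s x : R := x `^ s * expR (- x).

Lemma gamma_weight_ge0 s x : 0 <= gamma_weight s x.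
Proof. by rewrite mulr_ge0 ?powR_ge0 ?expR_ge0. Qed.

Lemma measurable_gamma_weight s (D : set R) :
  measurable_fun D (gamma_weight s).
Proof.
apply: measurable_funTS; apply: measurable_funM; first exact: measurable_powR.
exact: measurableT_comp.
Qed.

Lemma is_derive_gamma_weight s x : 0 < x ->
  is_derive x 1 (gamma_weight (s + 1))
    ((s + 1) * gamma_weight s x - gamma_weight (s + 1) x).
Proof.
move=> x0.
have d1 : is_derive x 1 (fun y : R => expR (- y)) (- expR (- x)).
  have := @is_derive1_comp R expR -%R x (expR (- x)) (-1).
  by rewrite mulrN1; apply.
have -> : (s + 1) * gamma_weight s x - gamma_weight (s + 1) x =
    x `^ (s + 1) *: - expR (- x) + expR (- x) *: ((s + 1) * x `^ (s + 1 - 1)).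
  by rewrite addrK /gamma_weight /GRing.scale/=; ring.
exact: (is_deriveM (is_derive1_powR (s + 1) x0) d1).
Qed.

Lemma continuous_gamma_weight s x : 0 < x -> {for x, continuous (gamma_weight s)}.
Proof.
move=> x0; rewrite -(subrK 1 s).
apply/differentiable_continuous/derivable1_diffP.
by have [] := is_derive_gamma_weight (s - 1) x0.
Qed.

Lemma gamma_weight_succ s x : 0 <= x -> -1 < s ->
  gamma_weight (s + 1) x = x * gamma_weight s x.
Proof.
move=> x0 s1; rewrite /gamma_weight mulrA; congr (_ * _).
by rewrite -(@mulr_powRB1 _ x (s + 1)) ?addrK//; lra.
Qed.

(** From ln y < y at y = x / (2c) comes c ln y <= x/2, so the power costs only half of the
    exponential decay; rescaling gives the factor (2c)^c. *)
Lemma gamma_weight_le c x : 0 < c -> 0 <= x ->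
  gamma_weight c x <= (2 * c) `^ c * expR (- (2^-1 * x)).
Proof.
move=> c0; rewrite le_eqVlt => /predU1P[<-|x0].
  by rewrite /gamma_weight powR0 ?gt_eqF// mul0r mulr_ge0 ?powR_ge0 ?expR_ge0.
have c2 : 0 < 2 * c by lra.
have -> : gamma_weight c x = (2 * c) `^ c * ((x / (2 * c)) `^ c * expR (- x)).
  rewrite mulrA -powRM ?divr_ge0 ?ltW// mulrC [_ * (x / _)]mulrC divfK ?gt_eqF//.
  exact: mulrC.
rewrite ler_wpM2l ?powR_ge0//.
rewrite {1}/powR gt_eqF ?divr_gt0// -expRD ler_expR.
have /ltW : ln (x / (2 * c)) < x / (2 * c) by rewrite ln_sublinear ?divr_gt0.
rewrite -(ler_pM2l c0).
rewrite (_ : c * (x / (2 * c)) = 2^-1 * x); last by field; lra.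
by lra.
Qed.

(** Domination by 2 (2c)^c times the exponential density of rate 1/2. Exponents in ]-1, 0] are
    reached later through the functional equation. *)
Lemma integrable_gamma_weight_gt0 c : 0 < c ->
  mu.-integrable `[0, +oo[ (EFin \o gamma_weight c).
Proof.
move=> c0.
have e0 : 0 < 2^-1 :> R by lra.
have : mu.-integrable `[0, +oo[
    (fun x => (2 * ((2 * c) `^ c))%:E * (exponential_pdf 2^-1 x)%:E)%E.
  apply: integrableZl => //.
  apply: integrableS (integrable_exponential_pdf e0) => //.
apply: le_integrable => //.
  by apply/measurable_EFinP; exact: measurable_gamma_weight.
move=> x /=; rewrite in_itv/= andbT => x0.
rewrite lee_fin ger0_norm ?gamma_weight_ge0//.
rewrite exponential_pdfE//.
rewrite (le_trans (gamma_weight_le c0 x0))//.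
rewrite (le_trans _ (ler_norm _))//.
by rewrite mulNr [leRHS](_ : _ = (2 * c) `^ c * expR (- (2^-1 * x)))//; field.
Qed.

Lemma gamma_weight_cvgy c : 0 < c -> gamma_weight c x @[x --> +oo] --> 0.
Proof.
move=> c0.
have h : (2 * c) `^ c * expR (- (2^-1 * x)) @[x --> +oo] --> 0.
  rewrite -[X in _ --> X](mulr0 ((2 * c) `^ c)).
  apply: cvgM; first exact: cvg_cst.
  apply: (@cvg_comp _ _ _ (fun x => 2^-1 * x) (fun x => expR (- x)) _ (pinfty_nbhs R)).
    exact: gt0_cvgMry.
  exact: cvgr_expR.
apply: (squeeze_cvgr _ (cvg_cst 0) h).
near=> x.
by rewrite gamma_weight_ge0/= gamma_weight_le.
Unshelve. all: by end_near. Qed.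

Lemma gamma_weight_cvg0 c : 0 < c -> gamma_weight c x @[x --> 0^'+] --> 0.
Proof.
move=> c0; rewrite -[X in _ --> X](mul0r (expR (- 0 : R))).
apply: cvgM; first exact: powR_cvg0.
apply: cvg_at_right_filter.
apply: continuous_comp; last exact: continuous_expR.
exact: (@continuousN _ R^o).
Qed.

(** Integration by parts, as the fundamental theorem of calculus for [gamma_weight (s + 1)]; a > 0
    avoids the possible singularity at 0. *)
Lemma integral_gamma_weight_segment s (a b : R) : 0 < a -> a < b ->
  ((s + 1)%:E * \int[mu]_(x in `[a, b]) (gamma_weight s x)%:E =
   \int[mu]_(x in `[a, b]) (gamma_weight (s + 1) x)%:E
   + (gamma_weight (s + 1) b - gamma_weight (s + 1) a)%:E)%E.
Proof.
move=> a0 ab.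
have cw t : {within `[a, b], continuous (gamma_weight t)}.
  apply: continuous_in_subspaceT => x; rewrite inE/= in_itv/= => /andP[ax _].
  by apply: continuous_gamma_weight; exact: lt_le_trans ax.
have iw t : mu.-integrable `[a, b] (EFin \o gamma_weight t).
  by apply: continuous_compact_integrable => //; exact: segment_compact.
have := @continuous_FTC2 R
  (fun x => (s + 1) * gamma_weight s x - gamma_weight (s + 1) x)
  (gamma_weight (s + 1)) a b ab.
have -> : (\int[mu]_(x in `[a, b])
    ((s + 1) * gamma_weight s x - gamma_weight (s + 1) x)%:E =
  (s + 1)%:E * \int[mu]_(x in `[a, b]) (gamma_weight s x)%:E -
   \int[mu]_(x in `[a, b]) (gamma_weight (s + 1) x)%:E)%E.
  have h : mu.-integrable `[a, b] (EFin \o (fun x => (s + 1) * gamma_weight s x)).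
    exact: (integrableZl _ (s + 1) (iw s)).
  rewrite -integralZl//; last exact: iw.
  have := integralB_EFin _ h (iw (s + 1)) => /= <-//.
have J_fin : (\int[mu]_(x in `[a, b]) (gamma_weight (s + 1) x)%:E)%E \is a fin_num.
  by apply: integrable_fin_num => //; exact: iw.
rewrite EFinB => <-; first by rewrite addeC subeK//.
- apply: continuous_in_subspaceT => x; rewrite inE/= in_itv/= => /andP[ax _].
  have x0 := lt_le_trans a0 ax.
  apply: cvgB; last exact: continuous_gamma_weight.
  by apply: cvgM; [exact: cvg_cst|exact: continuous_gamma_weight].
- split.
  + move=> x; rewrite in_itv/= => /andP[ax _].
    by have [] := is_derive_gamma_weight s (lt_trans a0 ax).
  + by apply: cvg_at_right_filter; apply: continuous_gamma_weight.
  + by apply: cvg_at_left_filter; apply: continuous_gamma_weight; exact: lt_trans ab.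
- move=> x; rewrite in_itv/= => /andP[ax _]; rewrite derive1E.
  by have [_ ->] := is_derive_gamma_weight s (lt_trans a0 ax).
Qed.

(** Monotone convergence along segments increasing to ]0, +oo[; the limit may be infinite. The shift
    by 2 keeps every segment nondegenerate. *)
Lemma integral_gamma_weight_cvg s :
  (\int[mu]_(x in `[(n.+2%:R^-1)%R, (n.+2%:R)%R]) (gamma_weight s x)%:E @[n --> \oo] -->
   \int[mu]_(x in `[0%R, +oo[) (gamma_weight s x)%:E)%E.
Proof.
have m D : measurable_fun D (EFin \o gamma_weight s).
  by apply/measurable_EFinP; exact: measurable_gamma_weight.
rewrite -integral_itv_obnd_cbnd//.
have <- : \bigcup_n `[(n.+2%:R : R)^-1, n.+2%:R]%classic = `]0, +oo[%classic.
  apply/seteqP; split=> x /=.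
    move=> [n _ /=]; rewrite !in_itv/= andbT => /andP[+ _].
    by apply: lt_le_trans; rewrite invr_gt0.
  rewrite in_itv/= andbT => x0.
  pose n := Num.bound (Num.max x x^-1).
  have nx : Num.max x x^-1 <= n.+2%:R.
    rewrite (@le_trans _ _ n%:R) ?ler_nat//; last by rewrite ltnW.
    by apply: ltW; apply: archi_boundP; rewrite le_max ltW.
  exists n => //=; rewrite in_itv/=.
  move: nx; rewrite ge_max => /andP[-> xn].
  by rewrite andbT -[leRHS]invrK lef_pV2// posrE ?invr_gt0.
apply: ge0_nondecreasing_set_cvg_integral => //.
- move=> i j ij; apply/subsetPset => x /=; rewrite !in_itv/= => /andP[h1 h2].
  rewrite (le_trans _ h1) ?(le_trans h2) ?ler_nat//.
  by rewrite lef_pV2 ?posrE// ler_nat.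
- by move=> i; exact: m.
- by move=> i x _; rewrite lee_fin gamma_weight_ge0.
Qed.

(** Gamma(s+2) = (s+1) Gamma(s+1): both sides are limits of the same sequence [u]. Working in the
    extended reals lets this precede, and then yield, integrability for s in ]-1, 0]. *)
Lemma integral_gamma_weight_succ s : -1 < s ->
  ((s + 1)%:E * \int[mu]_(x in `[0%R, +oo[) (gamma_weight s x)%:E =
   \int[mu]_(x in `[0%R, +oo[) (gamma_weight (s + 1) x)%:E)%E.
Proof.
move=> s1; have s0 : 0 < s + 1 by lra.
pose u n := ((s + 1)%:E * \int[mu]_(x in `[(n.+2%:R^-1)%R, (n.+2%:R)%R])
      (gamma_weight s x)%:E)%E.
have cvgl : (u n @[n --> \oo] -->
    (s + 1)%:E * \int[mu]_(x in `[0%R, +oo[) (gamma_weight s x)%:E)%E.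
  by apply: cvgeZl; [|exact: integral_gamma_weight_cvg].
suff cvgr : u n @[n --> \oo] -->
    (\int[mu]_(x in `[0%R, +oo[) (gamma_weight (s + 1) x)%:E)%E.
  by apply: cvg_unique cvgl cvgr; exact: ereal_hausdorff.
have uE n : u n = (\int[mu]_(x in `[(n.+2%:R^-1)%R, (n.+2%:R)%R])
      (gamma_weight (s + 1) x)%:E + (gamma_weight (s + 1) n.+2%:R
      - gamma_weight (s + 1) n.+2%:R^-1)%:E)%E.
  apply: integral_gamma_weight_segment; first by rewrite invr_gt0.
  by rewrite (@lt_trans _ _ 1) ?invf_lt1 ?ltr1n.
have n_cvgy : (n.+2%:R : R) @[n --> \oo] --> +oo.
  apply/cvgryPge => A; near=> n.
  apply: (@le_trans _ _ n%:R); last by rewrite ler_nat -addn2 leq_addr.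
  by near: n; exact: nbhs_infty_ger.
(* The boundary terms vanish at both ends because s + 1 > 0. *)
have lim0 : ((gamma_weight (s + 1) n.+2%:R
      - gamma_weight (s + 1) n.+2%:R^-1)%:E @[n --> \oo] --> 0)%E.
  apply/cvg_EFin; first exact: nearW.
  have cvgy : gamma_weight (s + 1) n.+2%:R @[n --> \oo] --> 0.
    exact: cvg_comp n_cvgy (gamma_weight_cvgy s0).
  have cvg0 : gamma_weight (s + 1) n.+2%:R^-1 @[n --> \oo] --> 0.
    move/cvg_at_rightP : (gamma_weight_cvg0 s0); apply.
    split; first by move=> n; rewrite invr_gt0.
    by apply/gtr0_cvgV0 => //; exact: nearW.
  by rewrite -[X in _ --> X](subr0 0); exact: cvgB.
rewrite (eq_cvg _ _ uE).
have := cvgeD _ (@integral_gamma_weight_cvg (s + 1)) lim0.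
by rewrite adde0; apply; rewrite fin_num_adde_defl.
Unshelve. all: by end_near. Qed.

(** An infinite integral at s, multiplied by s + 1 > 0, would force an infinite one at s + 1, where
    integrability is known. *)
Lemma integrable_gamma_weight s : -1 < s ->
  mu.-integrable `[0, +oo[ (EFin \o gamma_weight s).
Proof.
move=> s1; have s0 : 0 < s + 1 by lra.
have /integrable_fin_num := integrable_gamma_weight_gt0 s0.
rewrite -integral_gamma_weight_succ// => h.
apply/integrableP; split.
  by apply/measurable_EFinP; exact: measurable_gamma_weight.
under eq_integral do rewrite /= ger0_norm ?gamma_weight_ge0//.
rewrite ltNge leye_eq; apply/negP => /eqP e; move: h; rewrite e.
by rewrite gt0_muley ?lte_fin// => /(_ (measurable_itv _)).
Qed.

(** A zero integral would make the weight vanish almost everywhere on ]0,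
    +oo[, yet it is positive on ]0, 1[. *)
Lemma integral_gamma_weight_gt0 s :
  (0 < \int[mu]_(x in `[0%R, +oo[) (gamma_weight s x)%:E)%E.
Proof.
rewrite lt_neqAle integral_ge0 ?andbT; last first.
  by move=> x _; rewrite lee_fin gamma_weight_ge0.
apply/eqP => /esym e.
have : (\int[mu]_(x in `]0%R, +oo[) `|(gamma_weight s x)%:E| = 0)%E.
  rewrite integral_itv_obnd_cbnd.
    by rewrite -e; apply: eq_integral => x _; rewrite abse_EFin ger0_norm ?gamma_weight_ge0.
  apply: measurableT_comp => //.
  by apply/measurable_EFinP; exact: measurable_gamma_weight.
move/ae_eq_integral_abs => /(_ _ _)[]//.
  by apply/measurable_EFinP; exact: measurable_gamma_weight.
move=> A [mA A0 sA].
have A01 : `]0, 1[%classic `<=` A.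
  move=> x; rewrite /= in_itv/= => /andP[x0 _]; apply: sA => /= h.
  have := h _; rewrite in_itv/= x0 => /(_ isT) [] /eqP.
  by rewrite gt_eqF// mulr_gt0 ?powR_gt0 ?expR_gt0.
have : (mu `]0%R, 1%R[ <= mu A)%E by apply: le_measure; rewrite ?inE.
by rewrite [mu A]A0 lebesgue_measure_itv/= lte_fin ltr01 sube0 leNgt lte01.
Qed.

End GammaWeight.

(** * The transform as an algebraic map on polynomials *)

Section MellinTransform.
Variable R : idomainType.
Implicit Types p q : {poly R}.

(** The normalised moment Gamma(s+n+1) / Gamma(s+1), as a polynomial in s. *)
Definition rising_poly (n : nat) : {poly R} :=
  \prod_(k < n) ('X + (k.+1%:R)%:P).

(** Defined on coefficients, free of integrals; [integral_horner_gamma_weight] links it to the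
    integral. *)
Definition mellin p : {poly R} := \sum_(i < size p) p`_i *: rising_poly i.

Lemma monic_rising_poly n : rising_poly n \is monic.
Proof. by apply: monic_prod => i _; rewrite monicXaddC. Qed.

Lemma size_rising_poly n : size (rising_poly n) = n.+1.
Proof.
rewrite /rising_poly; under eq_bigr do rewrite -[X in 'X + X]opprK -polyCN.
by rewrite size_prod_XsubC /index_enum -enumT size_enum_ord.
Qed.

(** Splitting off the first factor, not the last, exposes the shift of s used in [mellinXM]. *)
Lemma rising_polyS n :
  rising_poly n.+1 = ('X + 1) * (rising_poly n \Po ('X + 1)).
Proof.
rewrite /rising_poly big_ord_recl rmorph_prod; congr (_ * _).
apply: eq_bigr => i _; rewrite /= comp_polyD comp_polyX comp_polyC.
by rewrite -addrA -polyC1 -polyCD nat1r.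
Qed.

Lemma mellin_widen n p : (size p <= n)%N ->
  mellin p = \sum_(i < n) p`_i *: rising_poly i.
Proof.
move=> pn; rewrite /mellin (big_ord_widen n (fun i => p`_i *: rising_poly i))//.
rewrite big_mkcond; apply: eq_bigr => i _.
by case: ltnP => // h; rewrite nth_default// scale0r.
Qed.

Lemma mellin_is_linear : linear mellin.
Proof.
move=> a p q; pose n := maxn (size p) (size q).
have hn : (size (a *: p + q)%R <= n)%N.
  rewrite (leq_trans (size_polyD _ _))// geq_max leq_maxr andbT.
  by rewrite (leq_trans (size_scale_leq _ _)) ?leq_maxl.
rewrite (mellin_widen hn) (@mellin_widen n p) ?leq_maxl//.
rewrite (@mellin_widen n q) ?leq_maxr// scaler_sumr -big_split/=.
by apply: eq_bigr => i _; rewrite coefD coefZ scalerDl scalerA.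
Qed.

HB.instance Definition _ :=
  GRing.isLinear.Build R {poly R} {poly R} _ mellin mellin_is_linear.

Lemma mellinC c : mellin c%:P = c%:P.
Proof.
rewrite (@mellin_widen 1) ?size_polyC ?leq_b1// big_ord1 coefC eqxx.
by rewrite /rising_poly big_ord0 -mul_polyC mulr1.
Qed.

Lemma mellinXM p : mellin ('X * p) = ('X + 1) * (mellin p \Po ('X + 1)).
Proof.
have h : (size ('X * p)%R <= (size p).+1)%N.
  by rewrite (leq_trans (size_polyMleq _ _))// size_polyX.
rewrite (mellin_widen h) big_ord_recl coefXM eqxx scale0r add0r.
rewrite /mellin raddf_sum mulr_sumr; apply: eq_bigr => i _ /=.
by rewrite coefXM/= comp_polyZ rising_polyS scalerAr.
Qed.

(** For x = alpha_j > -1 the rising product is nonzero, so orthogonality to x^k becomes a zero of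
    the transform at alpha_j + k. *)
Lemma horner_mellinXnM k p x : (mellin ('X^k * p)).[x] =
  \prod_(i < k) (x + 1 + i%:R) * (mellin p).[x + k%:R].
Proof.
elim: k x => [|k IH] x; first by rewrite big_ord0 expr0 !mul1r addr0.
rewrite exprS -mulrA mellinXM hornerM horner_comp !hornerE IH big_ord_recl mulrA.
rewrite addr0; congr (_ * _ * _.[_]); last by rewrite -addrA nat1r.
by apply: eq_bigr => i _; rewrite lift0 -nat1r addrA.
Qed.


(** The map is triangular on monomials, [rising_poly i] being monic of degree i; injectivity will
    follow. *)
Lemma size_mellin_lead p :
  size (mellin p) = size p /\ lead_coef (mellin p) = lead_coef p.
Proof.
have [->|p0] := eqVneq p 0; first by rewrite -[0]/(0%:P) mellinC.
have e := polySpred p0; set m := (size p).-1 in e.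
have l0 : lead_coef p != 0 by rewrite lead_coef_eq0.
have szt : size (lead_coef p *: rising_poly m) = m.+1.
  by rewrite size_scale ?size_rising_poly.
rewrite /mellin e big_ord_recr /= -[p`_m]/(lead_coef p) addrC.
have lt : (size (\sum_(i < m) p`_i *: rising_poly i)%R < size (lead_coef p *: rising_poly m))%N.
  rewrite szt ltnS; apply: (leq_trans (size_sum _ _ _)).
  apply/bigmax_leqP => i _; apply: leq_trans (size_scale_leq _ _) _.
  by rewrite size_rising_poly.
by rewrite size_polyDl// lead_coefDl// lead_coefZ (monicP (monic_rising_poly m)) mulr1.
Qed.
End MellinTransform.

(** * A polynomial identity tested at nodes and on one coefficient *)

Section PartialFractions.
Variables (F : fieldType) (r : nat).
Implicit Types t u a : 'I_r -> F.

(** In the difference [D] of the two sides the terms X^(r+1) cancel. The coefficient of X^r gives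
    the sum condition; once it vanishes, the values at the r distinct nodes t_j decide. *)
Lemma prod_XsubC_interpolation t u a (x y : F) : injective t ->
  ('X - x%:P) * \prod_i ('X - (u i)%:P) =
    ('X - y%:P) * \prod_i ('X - (t i)%:P)
    + \sum_j a j *: \prod_(i | i != j) ('X - (t i)%:P)
  <-> (forall j, (t j - x) * \prod_i (t j - u i)
                 = a j * \prod_(i | i != j) (t j - t i))
      /\ x + \sum_i u i = y + \sum_i t i.
Proof.
move=> t_inj.
pose D : {poly F} := ('X - x%:P) * \prod_i ('X - (u i)%:P)
  - ('X - y%:P) * \prod_i ('X - (t i)%:P)
  - \sum_j a j *: \prod_(i | i != j) ('X - (t i)%:P).
have szT j : size (\prod_(i | i != j) ('X - (t i)%:P)) = r.
  rewrite size_prod => [|i _]; last by rewrite polyXsubC_eq0.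
  rewrite (eq_bigr (fun=> 2)) => [|i _]; last by rewrite size_XsubC.
  (* The presence of j forces r > 0, so r - 1 factors give size r. *)
  rewrite sum_nat_const cardC1 card_ord; have := ltn_ord j; lia.
have szS : (size (\sum_j a j *: \prod_(i | i != j) ('X - (t i)%:P))%R <= r)%N.
  apply: (leq_trans (size_sum _ _ _)); apply/bigmax_leqP => j _.
  by rewrite (leq_trans (size_scale_leq _ _)) ?szT.
have prodE (z : F) (v : 'I_r -> F) : ('X - z%:P) * \prod_i ('X - (v i)%:P) =
    \prod_(w <- z :: [seq v i | i <- enum 'I_r]) ('X - w%:P).
  by rewrite big_cons big_map big_enum.
have szE (z : F) (v : 'I_r -> F) : size (z :: [seq v i | i <- enum 'I_r]) = r.+1.
  by rewrite /= size_map size_enum_ord.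
have Dr : D`_r = - (x + \sum_i u i) + (y + \sum_i t i).
  rewrite !coefB [X in _ - X]nth_default// subr0 !prodE.
  have top (z : F) (v : 'I_r -> F) :
    (\prod_(w <- z :: [seq v i | i <- enum 'I_r]) ('X - w%:P))`_r = - (z + \sum_i v i).
    have := @coefPn_prod_XsubC F (z :: [seq v i | i <- enum 'I_r]).
    by rewrite szE /= => ->//; rewrite big_cons big_map big_enum.
  by rewrite !top opprK.
have szD : (size D <= r.+1)%N.
  apply/leq_sizeP => j; rewrite leq_eqVlt => /predU1P[<-|rj].
    rewrite !coefB [X in _ - X]nth_default ?(leq_trans szS)// subr0 !prodE.
    have top (z : F) (v : 'I_r -> F) :
      (\prod_(w <- z :: [seq v i | i <- enum 'I_r]) ('X - w%:P))`_r.+1 = 1.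
      rewrite -(szE z v) -[size _]/(_.+1.-1) -(size_prod_XsubC _ id).
      exact/eqP/monic_prod_XsubC.
    by rewrite !top subrr.
  rewrite nth_default// (leq_trans (size_polyD _ _))// size_polyN geq_max.
  rewrite (leq_trans szS) ?andbT; last by rewrite ltnW // ltnW.
  rewrite (leq_trans (size_polyD _ _))// size_polyN geq_max.
  by rewrite !prodE !size_prod_XsubC !szE rj.
have Dt j : D.[t j] = (t j - x) * \prod_i (t j - u i)
                      - a j * \prod_(i | i != j) (t j - t i).
  have T0 : (\prod_i ('X - (t i)%:P)).[t j] = 0.
    by rewrite (bigD1 j)//= !hornerE subrr mul0r.
  have S0 : (\sum_k a k *: \prod_(i | i != k) ('X - (t i)%:P)).[t j] =
      a j * \prod_(i | i != j) (t j - t i).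
    rewrite horner_sum (bigD1 j)//= [X in _ + X]big1 => [|i ij].
      rewrite addr0 hornerZ horner_prod.
      by congr (_ * _); apply: eq_bigr => i _; rewrite !hornerE.
    by rewrite hornerZ horner_prod (bigD1 j) 1?eq_sym//= hornerXsubC subrr mul0r mulr0.
  rewrite 2!hornerD !hornerN S0 !hornerM T0 mulr0 subr0 horner_prod !hornerE.
  by congr (_ * _ - _); apply: eq_bigr => i _; rewrite !hornerE.
transitivity (D = 0).
  rewrite /D -addrA -opprD; split=> [->|/eqP]; first exact: subrr.
  by rewrite subr_eq0 => /eqP.
split=> [D0|[Hj Hr]].
  split=> [j|]; first by apply/eqP; rewrite -subr_eq0 -Dt D0 horner0.
  by apply/eqP; rewrite -subr_eq0 -oppr_eq0 opprB addrC -Dr D0 coef0.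
have {}szD : (size D <= r)%N.
  apply/leq_sizeP => j; rewrite leq_eqVlt => /predU1P[<-|rj].
    by rewrite Dr Hr addNr.
  by rewrite nth_default// (leq_trans szD).
(* A nonzero [D] with the r distinct roots t_j would have size above r. *)
apply: contraTeq szD => /max_poly_roots H.
rewrite -ltnNge -(size_enum_ord r) -(size_map t); apply: H.
  by apply/allP => _ /mapP[j _ ->]; rewrite /root Dt Hj subrr.
by rewrite map_inj_uniq ?enum_uniq.
Qed.
End PartialFractions.

(** * Transforms of the multiple Laguerre polynomials and their recurrence *)

Section LaguerreSymbol.
Variables (F : archiRealFieldType) (r : nat) (alpha : 'I_r -> F).
Implicit Types (n : multi_index r) (j k : 'I_r).

Definition laguerre_symbol n : {poly F} :=
  \prod_j \prod_(k < n j) ('X - (alpha j + k%:R)%:P).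

Lemma laguerre_symbol_neq0 n : laguerre_symbol n != 0.
Proof.
by apply/monic_neq0/monic_prod => j _; apply: monic_prod_XsubC.
Qed.

Lemma laguerre_symbol_incr n k :
  laguerre_symbol (mi_incr n k) =
  laguerre_symbol n * ('X - (alpha k + (n k)%:R)%:P).
Proof.
rewrite /laguerre_symbol (bigD1 k)//= [in RHS](bigD1 k)//= ffunE eqxx addn1.
rewrite big_ord_recr/= -!mulrA; congr (_ * _); rewrite mulrC; congr (_ * _).
by apply: eq_bigr => j /negPf jk; rewrite ffunE jk addn0.
Qed.

Lemma laguerre_symbol_decr n k : (0 < n k)%N ->
  laguerre_symbol (mi_decr n k) * ('X - (alpha k + (n k)%:R - 1)%:P) =
  laguerre_symbol n.
Proof.
move=> nk; have -> : n = mi_incr (mi_decr n k) k.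
  apply/ffunP => i; rewrite !ffunE.
  by have [->|_] := eqVneq i k; rewrite ?subnK// subn0 addn0.
set m := mi_decr n k.
have -> : mi_decr (mi_incr m k) k = m.
  by apply/ffunP => i; rewrite !ffunE addnK.
rewrite laguerre_symbol_incr; congr (_ * ('X - _%:P)).
by rewrite ffunE eqxx addn1 -natr1 addrA addrK.
Qed.

(** Replacing s by s + 1 moves each string of roots down by one: alpha_i - 1 enters, alpha_i + n_i -
    1 leaves. The cross-multiplied form also covers n_i = 0. *)
Lemma laguerre_symbol_shift n :
  (laguerre_symbol n \Po ('X + 1)) *
    \prod_i ('X - (alpha i + (n i)%:R - 1)%:P) =
  laguerre_symbol n * \prod_i ('X - (alpha i - 1)%:P).
Proof.
rewrite /laguerre_symbol rmorph_prod -!big_split/=; apply: eq_bigr => i _.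
rewrite rmorph_prod/=.
under eq_bigr do rewrite comp_polyB comp_polyX comp_polyC.
elim: (n i) => [|m IH]; first by rewrite !big_ord0 addr0.
rewrite !big_ord_recr/=.
have -> : 'X + 1 - (alpha i + m%:R)%:P = 'X - (alpha i + m%:R - 1)%:P :> {poly F}.
  by rewrite polyCB polyC1; ring.
rewrite IH -natr1 addrA addrK; ring.
Qed.

Hypothesis alpha_int : forall i j, i != j -> alpha i - alpha j \isn't a Num.int.

(** Serves twice: strings of roots for different indices never meet, and the nodes t_j are
    distinct. *)
Lemma shifted_param_inj i j (k l : F) : k \is a Num.int -> l \is a Num.int ->
  alpha i + k = alpha j + l -> i = j.
Proof.
move=> ik il e; apply/eqP; apply: contraT => /alpha_int.
by rewrite (_ : alpha i - alpha j = l - k) ?rpredB//; lra.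
Qed.

(** The prescribed roots are |n| distinct numbers, hence all the roots of a monic polynomial of
    degree |n|. *)
Lemma laguerre_symbol_unique n p : p \is monic -> size p = (mi_norm n).+1 ->
  (forall j (k : nat), (k < n j)%N -> root p (alpha j + k%:R)) ->
  p = laguerre_symbol n.
Proof.
move=> p_monic szp rootp.
pose rs := [seq alpha j + m%:R | j <- enum 'I_r, m <- iota 0 (n j)].
have szrs : size rs = mi_norm n.
  rewrite size_allpairs_dep sumnE big_map /mi_norm big_enum.
  by apply: eq_bigr => j _; rewrite size_iota.
have -> : laguerre_symbol n = \prod_(z <- rs) ('X - z%:P).
  rewrite big_allpairs_dep big_enum; apply: eq_bigr => j _.
  rewrite -(big_mkord xpredT (fun m => 'X - (alpha j + m%:R)%:P)).
  by rewrite /index_iota subn0.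
rewrite -[RHS]scale1r -(monicP p_monic).
apply: all_roots_prod_XsubC; first by rewrite szp szrs.
  apply/allP => _ /allpairsPdep[j [k [_ kn ->]]]; apply: rootp.
  by move: kn; rewrite mem_iota.
rewrite uniq_rootsE; apply: allpairs_uniq_dep; first exact: enum_uniq.
  by move=> j _; apply: iota_uniq.
move=> [i k] [j l] _ _ /= e.
have ij := shifted_param_inj (natr_int _ k) (natr_int _ l) e.
move: e; rewrite ij => /addrI/eqP; rewrite eqr_nat => /eqP kl.
by rewrite kl.
Qed.

(** Multiplying by [T] and cancelling [laguerre_symbol n], both nonzero, reduces the recurrence
    reversibly to the interpolation identity. *)
Lemma laguerre_symbol_recurrence n (a b : 'I_r -> F) k :
  (forall j, n j = 0%N -> a j = 0) ->
  ('X + 1) * (laguerre_symbol n \Po ('X + 1)) =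
    laguerre_symbol (mi_incr n k) + b k *: laguerre_symbol n
    + \sum_(j < r | (0 < n j)%N) a j *: laguerre_symbol (mi_decr n j)
  <-> (forall j,
     a j = (n j)%:R * ((n j)%:R + alpha j) *
       \prod_(i < r | i != j)
          (((n j)%:R + alpha j - alpha i)
           / ((n j)%:R - (n i)%:R + alpha j - alpha i)))
  /\ b k = (mi_norm n)%:R + (n k)%:R + alpha k + 1.
Proof.
move=> a0.
(* The roots t_j leave and the u_j enter under the shift; y absorbs b_k, as X - (alpha_k + n_k) +
   b_k = X - y. *)
pose t j := alpha j + (n j)%:R - 1; pose u j := alpha j - 1.
pose T : {poly F} := \prod_i ('X - (t i)%:P).
pose U : {poly F} := \prod_i ('X - (u i)%:P).
pose y := alpha k + (n k)%:R - b k.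
have T0 : T != 0 by apply/monic_neq0/monic_prod_XsubC.
have t_inj : injective t.
  move=> i j; rewrite /t => /addIr; apply: shifted_param_inj; exact: natr_int.
have denom i j : i != j -> t j - t i != 0.
  by rewrite subr_eq0 eq_sym (inj_eq t_inj).
apply: (@iff_trans _ (('X - (-1)%:P) * U =
    ('X - y%:P) * T + \sum_j a j *: \prod_(i | i != j) ('X - (t i)%:P))).
  have lhsE : ('X + 1) * (laguerre_symbol n \Po ('X + 1)) * T =
      laguerre_symbol n * (('X - (-1)%:P) * U).
    by rewrite -mulrA laguerre_symbol_shift polyCN polyC1 opprK mulrCA.
  have rhsE : (laguerre_symbol (mi_incr n k) + b k *: laguerre_symbol n
    + \sum_(j < r | (0 < n j)%N) a j *: laguerre_symbol (mi_decr n j)) * T =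
    laguerre_symbol n * (('X - y%:P) * T
      + \sum_j a j *: \prod_(i | i != j) ('X - (t i)%:P)).
    rewrite mulrDl mulrDr mulrA; congr (_ * T + _).
      by rewrite laguerre_symbol_incr -mul_polyC /y [in RHS]polyCB; ring.
    (* By [a0] the sum over n_j > 0 extends to all j, as interpolation requires. *)
    rewrite mulr_suml mulr_sumr [RHS](bigID (fun j => 0 < n j)%N)/=.
    rewrite [X in _ = _ + X]big1 ?addr0 => [|j]; last first.
      by rewrite -eqn0Ngt => /eqP/a0->; rewrite scale0r mulr0.
    apply: eq_bigr => j nj; rewrite -scalerAl -scalerAr; congr (_ *: _).
    by rewrite /T (bigD1 j)//= mulrA laguerre_symbol_decr.
  split=> [e|e].
    by apply: (mulfI (laguerre_symbol_neq0 n)); rewrite -lhsE -rhsE e.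
  by apply: (mulIf T0); rewrite lhsE rhsE e.
apply: (iff_trans (prod_XsubC_interpolation u a (-1) y t_inj)).
(* Since t_i - u_i = n_i, the condition reads -1 = y + |n|, which is linear in b_k. *)
have -> : (-1 + \sum_i u i = y + \sum_i t i) <->
    b k = (mi_norm n)%:R + (n k)%:R + alpha k + 1.
  rewrite /t /u /y /mi_norm !big_split/= natr_sum.
  by split => H; lra.
suff H j : (t j - -1) * \prod_i (t j - u i) = a j * \prod_(i | i != j) (t j - t i)
  <-> a j = (n j)%:R * ((n j)%:R + alpha j) *
       \prod_(i < r | i != j)
          (((n j)%:R + alpha j - alpha i)
           / ((n j)%:R - (n i)%:R + alpha j - alpha i)).
  by split=> -[h ->]; split=> // j; apply/H.
have P0 : \prod_(i | i != j) (t j - t i) != 0 by apply/prodf_neq0 => i /denom.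
(* Here t_j + 1 = n_j + alpha_j and the factor i = j is t_j - u_j = n_j; the other factors pair up
   into the quotients. *)
have -> : (n j)%:R * ((n j)%:R + alpha j) *
       \prod_(i < r | i != j)
          (((n j)%:R + alpha j - alpha i)
           / ((n j)%:R - (n i)%:R + alpha j - alpha i)) =
  (t j - -1) * \prod_i (t j - u i) / \prod_(i | i != j) (t j - t i).
  rewrite [in RHS](bigD1 j)//= -!mulrA -prodf_div mulrCA.
  have -> : t j - u j = (n j)%:R by rewrite /t /u; ring.
  congr (_ * (_ * _)); first by rewrite /t; ring.
  by apply: eq_bigr => i _; congr (_ / _); rewrite /t /u; ring.
by split=> [->|->]; rewrite ?mulfK ?divfK.
Qed.
End LaguerreSymbol.

(** * Moments as values of the transform *)

Section PolynomialMoments.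
Variable R : realType.
Local Notation mu := (@lebesgue_measure R).

(** Induction on p with s varying: a factor x is absorbed into the weight, raising s by one, and the
    functional equation returns to s. Integrability is carried along to split the integral of a
    sum. *)
Lemma integral_horner_gamma_weight (p : {poly R}) (s : R) : -1 < s ->
  mu.-integrable `[0, +oo[ (fun x => (p.[x] * gamma_weight s x)%:E) /\
  (\int[mu]_(x in `[0%R, +oo[) (p.[x] * gamma_weight s x)%:E =
   ((mellin p).[s])%:E * \int[mu]_(x in `[0%R, +oo[) (gamma_weight s x)%:E)%E.
Proof.
elim/poly_ind: p s => [|p c IH] s s1.
  have e : (fun x : R => ((0 : {poly R}).[x] * gamma_weight s x)%:E) = cst 0%E.
    by apply/funext => x; rewrite horner0 mul0r.
  rewrite e raddf0 horner0 mul0e integral0; split=> //.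
  exact: integrable0.
have [int_p p_eq] := IH (s + 1) (ltac:(lra)).
have int_c : mu.-integrable `[0, +oo[ (fun x => c%:E * (gamma_weight s x)%:E)%E.
  by apply: integrableZl => //; exact: integrable_gamma_weight.
have e : {in `[0, +oo[%classic,
    (fun x => (p.[x] * gamma_weight (s + 1) x)%:E + c%:E * (gamma_weight s x)%:E)%E
    =1 fun x => ((p * 'X + c%:P).[x] * gamma_weight s x)%:E}.
  move=> x; rewrite inE/= in_itv/= andbT => x0.
  rewrite gamma_weight_succ// -EFinM -EFinD; congr EFin.
  by rewrite hornerMXaddC; ring.
split.
  have eq_int := @eq_integrable _ _ _ mu _ _ _ _ e.
  by apply: eq_int => //; exact: (integrableD _ int_p int_c).
have <- := @eq_integral _ _ _ mu _ _ _ e; rewrite integralD// p_eq integralZl//; last first.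
  exact: integrable_gamma_weight.
rewrite -integral_gamma_weight_succ// muleA -muleDl//.
  congr (_ * _)%E.
  rewrite -EFinM -EFinD [mellin (_ + _)]raddfD /= mellinC [p * 'X]mulrC mellinXM; congr EFin.
  by rewrite !hornerE horner_comp !hornerE mulrC.
by apply: integrable_fin_num => //; exact: integrable_gamma_weight.
Qed.

Lemma mellin_multiple_laguerre1 (r : nat) (alpha : 'I_r -> R)
    (n : multi_index r) (p : {poly R}) :
  (forall j, -1 < alpha j) ->
  (forall i j, i != j -> alpha i - alpha j \isn't a Num.int) ->
  is_multiple_laguerre1 alpha n p -> mellin p = laguerre_symbol alpha n.
Proof.
move=> alpha_gt alpha_int [p_monic szp orth].
have [sz lead] := size_mellin_lead p.
apply: laguerre_symbol_unique => // [||j k kn].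
- by rewrite monicE lead -monicE.
- by rewrite sz.
have e : (fun x => (x ^+ k * p.[x] * (x `^ alpha j * expR (- x)))%:E) =
    (fun x => (('X^k * p).[x] * gamma_weight (alpha j) x)%:E).
  by apply/funext => x; rewrite hornerM hornerXn.
have [int_p intE] := integral_horner_gamma_weight ('X^k * p) (alpha_gt j).
(* The orthogonality integral omits the point 0, the moment formula includes it; a point has measure
   zero. *)
have := orth j k kn; rewrite e integral_itv_obnd_cbnd; last first.
  apply: measurable_funS (measurable_int mu int_p) => //.
  by apply: subset_itvr; rewrite bnd_simp.
rewrite intE.
move/eqP; rewrite mule_eq0 eqe [X in _ || X]gt_eqF ?integral_gamma_weight_gt0// orbF.
rewrite horner_mellinXnM mulf_eq0 => /orP[|]//.
rewrite prodf_seq_eq0 => /hasP[i _ /=]; rewrite gt_eqF//.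
by have := alpha_gt j; have := ler0n R i; lra.
Qed.
End PolynomialMoments.

(** * Transfer of the recurrence through the injective transform *)

Theorem mainTheorem5 (R : realType) (r : nat) (hr : (1 <= r)%N)
  (alpha : 'I_r -> R)
  (halpha : forall j : 'I_r, -1 < alpha j)
  (hdiff : forall i j : 'I_r, i != j -> alpha i - alpha j \isn't a Num.int)
  (L : multi_index r -> {poly R})
  (hL : forall n : multi_index r, is_multiple_laguerre1 alpha n (L n))
  (n : multi_index r) (a b : 'I_r -> R)
  (ha0 : forall j : 'I_r, n j = 0%N -> a j = 0) :
  (forall k : 'I_r,
     'X * L n = L (mi_incr n k) + b k *: L n
                + \sum_(j < r | (0 < n j)%N) a j *: L (mi_decr n j))
  <->
  (forall j : 'I_r,
     a j = (n j)%:R * ((n j)%:R + alpha j) *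
       \prod_(i < r | i != j)
          (((n j)%:R + alpha j - alpha i)
           / ((n j)%:R - (n i)%:R + alpha j - alpha i)))
  /\ (forall k : 'I_r, b k = (mi_norm n)%:R + (n k)%:R + alpha k + 1).
Proof.
have LE m := mellin_multiple_laguerre1 halpha hdiff (hL m).
(* Leading coefficients are preserved, so a difference sent to 0 is itself 0. *)
have mellin_inj : injective (@mellin R).
  move=> p q pq; apply/eqP; rewrite -subr_eq0 -lead_coef_eq0.
  by rewrite -(size_mellin_lead _).2 raddfB/= pq subrr lead_coef0.
have recE k := laguerre_symbol_recurrence hdiff b k ha0.
have mellinE k : mellin (L (mi_incr n k) + b k *: L n
      + \sum_(j < r | (0 < n j)%N) a j *: L (mi_decr n j)) =
    laguerre_symbol alpha (mi_incr n k) + b k *: laguerre_symbol alpha n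
    + \sum_(j < r | (0 < n j)%N) a j *: laguerre_symbol alpha (mi_decr n j).
  rewrite !raddfD raddf_sum /= linearZ /= !LE; congr (_ + _).
  by apply: eq_bigr => j _; rewrite linearZ /= LE.
split=> [rec|[aE bE] k].
  have coefE k := (recE k).1 (ltac:(by rewrite -mellinE -rec mellinXM LE)).
  (* The recurrence for a single k determines every a_j; [hr] supplies such a k. *)
  split=> [|k]; first by have [] := coefE (Ordinal hr).
  by have [] := coefE k.
by apply: mellin_inj; rewrite mellinE mellinXM LE; apply/recE.
Qed.
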